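(* Let $f:\mathbb{C}\to\mathbb{R}$ be a bounded continuous function such that for every $z\in\mathbb{C}$ $$f(z)=\frac{1}{2\pi}\int_0^{2\pi} f(z+e^{it})\,dt.$$ Then $f$ is constant.
   Context: The plane $\mathbb{R}^2$ is identified with $\mathbb{C}$. The hypothesis says that the average of $f$ (with respect to arc length) over every circle of radius $1$ equals the value of $f$ at the center of that circle; only circles of radius exactly $1$ are considered. *)

(* Defs.v *)
From Stdlib Require Import Reals.
From Coquelicot Require Import Coquelicot.
Open Scope R_scope.

(** [cis t] is [e^{it}], via Euler's formula; Coquelicot has no complex
    exponential. [C] is [R * R], with the real part first. *)
Definition cis (t : R) : C := (cos t, sin t).

(* Main.v *)
(** Raugi's proof of the Choquet-Deny theorem.  Let [P] be averaging over the unit circle and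
    [v = P (f^2) - f^2].  Since [P f = f], [v z] is the mean of [(f (z + e^(it)) - f z)^2] over [t],
    and Jensen's inequality applied to the harmonic functions [z |-> f (z + e^(it)) - f z] gives
    [v <= P v].  Hence [n v <= v + P v + ... + P^(n-1) v = P^n (f^2) - f^2] stays bounded
    as [n] grows, so [v = 0], i.e. [f (z + e^(it)) = f z] for all [z] and [t]. *)

Require Import Defs.
From Stdlib Require Import Reals Lra Classical IndefiniteDescription.
From Coquelicot Require Import Coquelicot.
Open Scope R_scope.

(** * Integrals of continuous functions: parameters, Fubini, vanishing *)

Lemma continuous_RInt_joint (U : UniformSpace) (h : U -> R -> R) (a b : R) (x : U) :
  a <= b ->
  (forall t, continuous (fun p : U * R => h (fst p) (snd p)) (x, t)) ->
  (forall y, ex_RInt (h y) a b) ->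
  continuous (fun y => RInt (h y) a b) x.
Proof.
intros ab hcont hint.
apply filterlim_locally; intros eps.
(* The [+ 1] keeps the denominator positive when [a = b] and makes the final bound
   [(b - a) * (2 * e)] strictly smaller than [eps]. *)
assert (e_pos : 0 < eps / (2 * (b - a) + 1)).
{ apply Rdiv_lt_0_compat; [apply cond_pos | lra]. }
set (e := mkposreal _ e_pos).
assert (near : forall t, exists d : posreal, forall y s,
  ball x d y -> Rabs (s - t) < d -> Rabs (h y s - h x t) < e).
{ intros t.
  destruct (proj1 (filterlim_locally _ _) (hcont t) e) as [d Hd].
  exists d; intros y s Hy Hs.
  apply (Hd (y, s)); split; [exact Hy | exact Hs]. }
(* Compactness of [[a, b]] makes the radius uniform: each [t] lies within [delta t0] of some [t0]
   with [d <= delta t0], so [h y t] and [h x t] are both within [e] of [h x t0]. *)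
destruct (functional_choice _ near) as [delta Hdelta].
destruct (compactness_value_1d a b delta) as [d Hd].
exists d; intros y Hy.
change (Rabs (RInt (h y) a b - RInt (h x) a b) < eps).
rewrite <- (RInt_minus (h y) (h x)) by apply hint.
apply Rle_lt_trans with ((b - a) * (2 * e)).
- apply abs_RInt_le_const; [exact ab | now apply @ex_RInt_minus |].
  intros t Ht.
  destruct (NNPP _ (Hd t Ht)) as [t0 [_ [Htt0 Hd0]]].
  assert (H1 := Hdelta t0 y t (ball_le _ _ _ Hd0 _ Hy) Htt0).
  assert (H2 := Hdelta t0 x t (ball_center _ _) Htt0).
  change (Rabs (h y t - h x t) <= 2 * e).
  replace (h y t - h x t) with ((h y t - h x t0) - (h x t - h x t0)) by ring.
  apply Rabs_def2 in H1; apply Rabs_def2 in H2.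
  apply Rabs_le; lra.
- replace (pos eps) with ((2 * (b - a) + 1) * e) by (simpl; field; lra).
  assert (0 < e) by apply cond_pos. nra.
Qed.

Section Fubini.
Variable h : R -> R -> R.
Hypothesis hcont : forall s t, continuous (fun p : R * R => h (fst p) (snd p)) (s, t).

Lemma continuous_slice_l (t s : R) : continuous (fun s => h s t) s.
Proof.
apply (continuous_comp_2 (fun s => s) (fun _ => t) h);
  [apply continuous_id | apply continuous_const | apply hcont].
Qed.

Lemma continuous_flip (s t : R) : continuous (fun p : R * R => h (snd p) (fst p)) (t, s).
Proof.
apply (continuous_comp_2 (fun p : R * R => snd p) (fun p => fst p) h);
  [apply continuous_snd | apply continuous_fst | apply hcont].
Qed.

Lemma ex_RInt_slice_l (t a b : R) : ex_RInt (fun s => h s t) a b.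
Proof. apply @ex_RInt_continuous; intros; apply continuous_slice_l. Qed.

Lemma continuous_RInt_l (a b t : R) : continuous (fun t => RInt (fun s => h s t) a b) t.
Proof.
assert (main : forall a b t, a <= b -> continuous (fun t => RInt (fun s => h s t) a b) t).
{ clear a b t; intros a b t ab.
  apply (continuous_RInt_joint R_UniformSpace (fun t s => h s t)).
  - exact ab.
  - intros s; apply (continuous_flip s t).
  - intros; apply ex_RInt_slice_l. }
destruct (Rle_dec a b) as [ab | ab]; [now apply main |].
apply (continuous_ext (fun t => opp (RInt (fun s => h s t) b a))).
- intros u; apply (@opp_RInt_swap R_CompleteNormedModule), ex_RInt_slice_l.
- apply @continuous_opp, main; lra.
Qed.
End Fubini.

Lemma continuous_RInt_r (h : R -> R -> R) (c d s : R) :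
  (forall s t, continuous (fun p : R * R => h (fst p) (snd p)) (s, t)) ->
  continuous (fun s => RInt (fun t => h s t) c d) s.
Proof.
intros hcont; apply (continuous_RInt_l (fun t s => h s t)).
intros; now apply continuous_flip.
Qed.

(* Both sides, as functions of [b], have derivative [RInt (h b) c d] and vanish at [a]. *)
Lemma RInt_swap (h : R -> R -> R) (a b c d : R) :
  (forall s t, continuous (fun p : R * R => h (fst p) (snd p)) (s, t)) ->
  RInt (fun s => RInt (fun t => h s t) c d) a b =
  RInt (fun t => RInt (fun s => h s t) a b) c d.
Proof.
intros hcont.
assert (hD : forall t x, is_derive (fun u => RInt (fun s => h s t) a u) x (h x t)).
{ intros t x.
  apply (is_derive_RInt (fun s => h s t) _ a).
  - apply filter_forall; intros u; apply (@RInt_correct R_CompleteNormedModule).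
    now apply ex_RInt_slice_l.
  - now apply (continuous_slice_l h hcont). }
assert (hder : forall x, is_derive
  (fun u => RInt (fun t => RInt (fun s => h s t) a u) c d) x (RInt (fun t => h x t) c d)).
{ intros x.
  replace (RInt (fun t => h x t) c d)
    with (RInt (fun t => Derive (fun u => RInt (fun s => h s t) a u) x) c d).
  2: { apply RInt_ext; intros t _; now apply is_derive_unique. }
  apply (is_derive_RInt_param (fun u t => RInt (fun s => h s t) a u)).
  - apply filter_forall; intros u t _; eexists; apply hD.
  - intros t _.
    apply continuity_2d_pt_ext with h.
    + intros u v; symmetry; now apply is_derive_unique.
    + apply continuity_2d_pt_filterlim, hcont.
  - apply filter_forall; intros u.
    apply @ex_RInt_continuous; intros t _; now apply continuous_RInt_l. }
apply (@is_RInt_unique R_CompleteNormedModule).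
replace (RInt (fun t => RInt (fun s => h s t) a b) c d)
  with (minus (RInt (fun t => RInt (fun s => h s t) a b) c d)
              (RInt (fun t => RInt (fun s => h s t) a a) c d)).
- apply (is_RInt_derive (fun u => RInt (fun t => RInt (fun s => h s t) a u) c d)).
  + intros x _; apply hder.
  + intros x _.
    now apply continuous_RInt_r.
- rewrite (RInt_ext (fun t => RInt (fun s => h s t) a a) (fun _ => 0)).
  2: { intros t _; apply (@RInt_point R_CompleteNormedModule). }
  rewrite RInt_const; unfold scal; simpl; unfold mult; simpl.
  unfold minus, plus, opp; simpl; ring.
Qed.

(** An iterated circle mean has a factor [1 / (2 * PI)] between its two integrals; this is Fubini in
    that shape. *)
Lemma RInt_scal_swap (h : R -> R -> R) (k a b c d : R) :
  (forall s t, continuous (fun p : R * R => h (fst p) (snd p)) (s, t)) ->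
  RInt (fun s => k * RInt (fun t => h s t) c d) a b =
  RInt (fun t => k * RInt (fun s => h s t) a b) c d.
Proof.
intros hcont.
rewrite (RInt_scal (V := R_CompleteNormedModule) (fun s => RInt (fun t => h s t) c d)).
- rewrite (RInt_scal (V := R_CompleteNormedModule) (fun t => RInt (fun s => h s t) a b)).
  + now rewrite RInt_swap.
  + apply @ex_RInt_continuous; intros; now apply continuous_RInt_l.
- apply @ex_RInt_continuous; intros; now apply continuous_RInt_r.
Qed.

(** Nonnegativity and additivity force the integral over every subinterval to vanish, whereas
    [g t > 0] would give a positive integral over a small interval around [t]. *)
Lemma RInt_nonneg_eq_0 (g : R -> R) (a b t : R) :
  (forall x, continuous g x) -> (forall x, 0 <= g x) ->
  RInt g a b = 0 -> a < t < b -> g t = 0.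
Proof.
intros gc gpos gint Ht.
assert (gi : forall u v, ex_RInt g u v).
{ intros; apply @ex_RInt_continuous; intros; apply gc. }
assert (I0 : forall u v, a <= u -> u < v -> v <= b -> RInt g u v = 0).
{ intros u v Hu Huv Hv.
  assert (E1 := RInt_Chasles g a u v (gi _ _) (gi _ _)).
  assert (E2 := RInt_Chasles g a v b (gi _ _) (gi _ _)).
  unfold plus in E1, E2; simpl in E1, E2.
  assert (0 <= RInt g a u) by (apply RInt_ge_0; auto).
  assert (0 <= RInt g u v) by (apply RInt_ge_0; auto; lra).
  assert (0 <= RInt g v b) by (apply RInt_ge_0; auto).
  lra. }
destruct (Rle_lt_or_eq_dec _ _ (gpos t)) as [gt | gt]; [exfalso | now symmetry].
destruct (proj1 (filterlim_locally _ _) (gc t) (mkposreal _ gt)) as [d Hd].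
(* Halving [d] puts the closed interval of radius [r] inside the open ball of radius [d]; the other
   two terms keep it inside [[a, b]]. *)
set (r := Rmin (d / 2) (Rmin (t - a) (b - t))).
assert (Hr : 0 < r /\ r <= d / 2 /\ r <= t - a /\ r <= b - t).
{ assert (0 < d) by apply cond_pos.
  unfold r; repeat apply conj; [repeat apply Rmin_glb_lt; lra | ..];
  unfold Rmin; repeat destruct Rle_dec; lra. }
assert (near : forall x, t - r <= x <= t + r -> 0 < g x).
{ intros x Hx.
  assert (Hb : Rabs (g x - g t) < g t).
  { apply (Hd x). change (Rabs (x - t) < d). assert (0 < d) by apply cond_pos.
    apply Rabs_def1; lra. }
  apply Rabs_def2 in Hb; lra. }
assert (0 < RInt g (t - r) (t + r)).
{ apply RInt_gt_0; [lra | intros; apply near; lra | intros; apply gc]. }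
rewrite I0 in H; lra.
Qed.

(** * The averaging operator over unit circles ([P] above) *)

Definition circle_mean (f : C -> R) (z : C) : R :=
  1 / (2 * PI) * RInt (fun t => f (Cplus z (cis t))) 0 (2 * PI).

Lemma two_PI_pos : 0 < 2 * PI.
Proof. assert (H := PI_RGT_0); lra. Qed.

Lemma continuous_Cplus (U : UniformSpace) (f g : U -> C) (x : U) :
  continuous f x -> continuous g x -> continuous (fun y => Cplus (f y) (g y)) x.
Proof. apply (@continuous_plus U R_AbsRing (prod_NormedModule _ R_NormedModule R_NormedModule)). Qed.

Lemma continuous_cis (t : R) : continuous cis t.
Proof.
apply (continuous_comp_2 cos sin (fun x y => (x, y))).
- apply continuous_cos.
- apply continuous_sin.
- apply (continuous_ext (fun p => p)); [now intros [] | apply continuous_id].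
Qed.

Lemma continuous_translate (f : C -> R) (w z : C) :
  (forall z, continuous f z) -> continuous (fun z => f (Cplus z w)) z.
Proof.
intros fc; apply (continuous_comp (fun z => Cplus z w)); [| apply fc].
apply continuous_Cplus; [apply continuous_id | apply continuous_const].
Qed.

Lemma continuous_on_circle (f : C -> R) (z : C) (t : R) :
  (forall z, continuous f z) -> continuous (fun t => f (Cplus z (cis t))) t.
Proof.
intros fc; apply (continuous_comp (fun t => Cplus z (cis t))); [| apply fc].
apply continuous_Cplus; [apply continuous_const | apply continuous_cis].
Qed.

Lemma ex_RInt_circle (f : C -> R) (z : C) (a b : R) :
  (forall z, continuous f z) -> ex_RInt (fun t => f (Cplus z (cis t))) a b.
Proof. intros fc; apply @ex_RInt_continuous; intros; now apply continuous_on_circle. Qed.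

Lemma continuous_circle_mean (f : C -> R) :
  (forall z, continuous f z) -> forall z, continuous (circle_mean f) z.
Proof.
intros fc z.
apply (continuous_scal_r (K := R_AbsRing) (V := R_NormedModule)).
apply (continuous_RInt_joint C_UniformSpace (fun z t => f (Cplus z (cis t)))).
- apply Rlt_le, two_PI_pos.
- intros t.
  apply (continuous_comp (fun p : C_UniformSpace * R => Cplus (fst p) (cis (snd p)))); [| apply fc].
  apply continuous_Cplus; [apply continuous_fst |].
  apply (continuous_comp (fun p : C_UniformSpace * R => snd p) cis);
    [apply continuous_snd | apply continuous_cis].
- intros; now apply ex_RInt_circle.
Qed.

Lemma circle_mean_const (c : R) (z : C) : circle_mean (fun _ => c) z = c.
Proof.
unfold circle_mean; rewrite RInt_const; unfold scal; simpl; unfold mult; simpl.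
field; apply PI_neq0.
Qed.

Lemma circle_mean_lin (f g : C -> R) (a b : R) (z : C) :
  (forall z, continuous f z) -> (forall z, continuous g z) ->
  circle_mean (fun w => a * f w + b * g w) z = a * circle_mean f z + b * circle_mean g z.
Proof.
intros fc gc; unfold circle_mean.
rewrite (RInt_plus (fun t => scal a (f (Cplus z (cis t)))) (fun t => scal b (g (Cplus z (cis t))))).
- rewrite !(RInt_scal (V := R_CompleteNormedModule)) by now apply ex_RInt_circle.
  unfold plus, scal; simpl; unfold mult; simpl; ring.
- now apply @ex_RInt_scal, ex_RInt_circle.
- now apply @ex_RInt_scal, ex_RInt_circle.
Qed.

Lemma circle_mean_ext (f g : C -> R) (z : C) :
  (forall w, f w = g w) -> circle_mean f z = circle_mean g z.
Proof. intros fg; unfold circle_mean; f_equal; apply RInt_ext; intros; apply fg. Qed.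

Lemma circle_mean_le (f g : C -> R) (z : C) :
  (forall z, continuous f z) -> (forall z, continuous g z) ->
  (forall w, f w <= g w) -> circle_mean f z <= circle_mean g z.
Proof.
intros fc gc fg; assert (H := two_PI_pos).
apply Rmult_le_compat_l.
- apply Rlt_le, Rdiv_lt_0_compat; lra.
- apply RInt_le; [lra | now apply ex_RInt_circle | now apply ex_RInt_circle | intros; apply fg].
Qed.

Lemma continuous_sqr (f : C -> R) (z : C) :
  continuous f z -> continuous (fun w => f w * f w) z.
Proof. intros fc; now apply (continuous_mult (K := R_AbsRing) f f). Qed.

Lemma continuous_sub (f g : C -> R) (z : C) :
  continuous f z -> continuous g z -> continuous (fun w => f w - g w) z.
Proof. apply (continuous_minus (K := R_AbsRing) (V := R_NormedModule)). Qed.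

Lemma circle_mean_sub (f g : C -> R) (z : C) :
  (forall z, continuous f z) -> (forall z, continuous g z) ->
  circle_mean (fun w => f w - g w) z = circle_mean f z - circle_mean g z.
Proof.
intros fc gc.
rewrite (circle_mean_ext _ (fun w => 1 * f w + (-1) * g w)) by (intros; ring).
rewrite circle_mean_lin by assumption; ring.
Qed.

(** Linearity after expanding the square. The constant [c] is left free: [c = circle_mean f z] gives
    Jensen's inequality, and [c = f z] the variance formula. *)
Lemma circle_mean_sqr_dev (f : C -> R) (c : R) (z : C) :
  (forall z, continuous f z) ->
  circle_mean (fun w => (f w - c) * (f w - c)) z =
  circle_mean (fun w => f w * f w) z - 2 * c * circle_mean f z + c * c.
Proof.
intros fc.
assert (f2c : forall z, continuous (fun w => f w * f w) z) by (intros; now apply continuous_sqr).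
assert (kc : forall z, continuous (fun _ : C => c * c) z) by (intros; apply continuous_const).
rewrite (circle_mean_ext _ (fun w => 1 * (f w * f w) + 1 * (-2 * c * f w + 1 * (c * c)))) by (intros; ring).
rewrite circle_mean_lin; [rewrite circle_mean_lin; trivial | trivial |].
- rewrite circle_mean_const; ring.
- intros w; apply (continuous_plus (fun w => -2 * c * f w)).
  + now apply (continuous_scal_r (K := R_AbsRing) (V := R_NormedModule)).
  + apply continuous_const.
Qed.

(** The difference of the two sides is the mean of the squared deviation from the mean. *)
Lemma circle_mean_jensen (f : C -> R) (z : C) :
  (forall z, continuous f z) ->
  circle_mean f z * circle_mean f z <= circle_mean (fun w => f w * f w) z.
Proof.
intros fc.
assert (H : 0 <= circle_mean (fun w => (f w - circle_mean f z) * (f w - circle_mean f z)) z).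
{ rewrite <- (circle_mean_const 0 z).
  apply circle_mean_le.
  - intros; apply continuous_const.
  - intros w; apply (continuous_sqr (fun w => f w - circle_mean f z)).
    apply continuous_sub; [apply fc | apply continuous_const].
  - intros w; apply Rle_0_sqr. }
rewrite circle_mean_sqr_dev in H by assumption; lra.
Qed.

(** The bound survives because averaging is monotone and fixes constants; continuity is carried
    through the same induction since monotonicity requires it. *)
Lemma circle_mean_iter_le (u : C -> R) (B : R) (n : nat) :
  (forall z, continuous u z) -> (forall z, u z <= B) ->
  (forall z, continuous (Nat.iter n circle_mean u) z) /\
  (forall z, Nat.iter n circle_mean u z <= B).
Proof.
intros uc uB; induction n as [| n [IHc IHB]]; [now split |]; split; intros z; simpl.
- now apply continuous_circle_mean.
- rewrite <- (circle_mean_const B z); apply circle_mean_le; trivial.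
  intros; apply continuous_const.
Qed.

(* Telescoping: [u + n v <= P^n u <= B], so that [v <= (B - u) / n] for every [n > 0]. *)
Lemma circle_mean_increment_le_0 (u : C -> R) (B : R) :
  (forall z, continuous u z) -> (forall z, u z <= B) ->
  (forall z, circle_mean u z - u z <= circle_mean (fun w => circle_mean u w - u w) z) ->
  forall z, circle_mean u z - u z <= 0.
Proof.
intros uc uB; set (v := fun z => circle_mean u z - u z).
intros vsub.
assert (vc : forall z, continuous v z).
{ intros; apply continuous_sub; [now apply continuous_circle_mean | apply uc]. }
assert (tele : forall n z, u z + INR n * v z <= Nat.iter n circle_mean u z).
{ induction n as [| n IH]; intros z; [simpl; lra |].
  (* Averaging the induction hypothesis: [P (u + n v) = P u + n P v >= (u + v) + n v], by [vsub]. *)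
  apply Rle_trans with (circle_mean (fun w => 1 * u w + INR n * v w) z).
  - rewrite circle_mean_lin by assumption.
    assert (H := Rmult_le_compat_l _ _ _ (pos_INR n) (vsub z)).
    rewrite S_INR; unfold v in *; lra.
  - apply circle_mean_le.
    + intros w; apply (continuous_plus (fun w => 1 * u w) (fun w => INR n * v w));
      now apply (continuous_scal_r (K := R_AbsRing) (V := R_NormedModule)).
    + now apply (circle_mean_iter_le u B).
    + intros w; rewrite Rmult_1_l; apply IH. }
intros z; change (v z <= 0); apply Rnot_lt_le; intros vpos.
destruct (INR_unbounded ((B - u z) / v z)) as [n Hn].
assert (H1 := tele n z).
assert (H2 := proj2 (circle_mean_iter_le u B n uc uB) z).
apply (Rmult_lt_compat_r _ _ _ vpos) in Hn.
replace ((B - u z) / v z * v z) with (B - u z) in Hn by (field; lra).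
lra.
Qed.

(** * The variance of a function equal to its circle means *)

Section Harmonic.
Variable f : C -> R.
Hypothesis fc : forall z, continuous f z.
Hypothesis f_mean : forall z, f z = circle_mean f z.

Definition variance (z : C) : R := circle_mean (fun w => f w * f w) z - f z * f z.

Lemma variance_eq (z : C) :
  variance z = circle_mean (fun w => (f w - f z) * (f w - f z)) z.
Proof. rewrite circle_mean_sqr_dev, <- f_mean by exact fc; unfold variance; ring. Qed.

(** For fixed [t], Jensen's inequality bounds the squared increment at [z] by its mean over the
    points [z + e^(is)]. Averaging over [t] and exchanging the two integrals yields the mean of the
    variances at these points. *)
Lemma variance_sub_mean (z : C) : variance z <= circle_mean variance z.
Proof.
assert (Hpi := two_PI_pos).
set (D := fun s t => f (Cplus (Cplus z (cis s)) (cis t)) - f (Cplus z (cis s))).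
assert (Dc : forall s t, continuous (fun p : R * R => D (fst p) (snd p) * D (fst p) (snd p)) (s, t)).
{ intros s t.
  assert (c1 : continuous (fun p : R * R => Cplus z (cis (fst p))) (s, t)).
  { apply continuous_Cplus; [apply continuous_const |].
    apply (continuous_comp (fun p : R * R => fst p) cis); [apply continuous_fst | apply continuous_cis]. }
  assert (c2 : continuous (fun p : R * R => Cplus (Cplus z (cis (fst p))) (cis (snd p))) (s, t)).
  { apply continuous_Cplus; [exact c1 |].
    apply (continuous_comp (fun p : R * R => snd p) cis); [apply continuous_snd | apply continuous_cis]. }
  assert (c : continuous (fun p : R * R => D (fst p) (snd p)) (s, t)).
  { apply (continuous_minus (K := R_AbsRing) (V := R_NormedModule)
             (fun p : R * R => f (Cplus (Cplus z (cis (fst p))) (cis (snd p))))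
             (fun p : R * R => f (Cplus z (cis (fst p))))).
    - apply (continuous_comp _ f _ c2), fc.
    - apply (continuous_comp _ f _ c1), fc. }
  now apply (continuous_mult (K := R_AbsRing) (fun p : R * R => D (fst p) (snd p)) (fun p : R * R => D (fst p) (snd p))). }
(* The order with [s] innermost is the one in which Jensen's inequality applies for each [t]. *)
replace (circle_mean variance z) with
  (1 / (2 * PI) * RInt (fun t => 1 / (2 * PI) * RInt (fun s => D s t * D s t) 0 (2 * PI)) 0 (2 * PI)).
- rewrite variance_eq.
  apply Rmult_le_compat_l; [apply Rlt_le, Rdiv_lt_0_compat; lra |].
  apply RInt_le; [lra | | |].
  + apply (ex_RInt_circle (fun w => (f w - f z) * (f w - f z))).
    intros w; apply (continuous_sqr (fun w => f w - f z)), continuous_sub;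
      [apply fc | apply continuous_const].
  + apply (@ex_RInt_scal R_NormedModule), @ex_RInt_continuous.
    intros t _; now apply (continuous_RInt_l (fun s t => D s t * D s t)).
  + intros t _.
    set (k := fun w => f (Cplus w (cis t)) - f w).
    assert (kc : forall w, continuous k w).
    { intros w; apply continuous_sub; [now apply continuous_translate | apply fc]. }
    assert (k_mean : f (Cplus z (cis t)) - f z = circle_mean k z).
    { unfold k; rewrite circle_mean_sub; trivial.
      2: intros; now apply continuous_translate.
      (* The mean of [f] around [z + e^(it)] is the mean over [s] of [f (z + e^(is) + e^(it))],
         because addition commutes. *)
      rewrite <- f_mean, f_mean at 1; f_equal.
      unfold circle_mean; f_equal; apply RInt_ext; intros s _.
      f_equal; ring. }
    rewrite k_mean.
    exact (circle_mean_jensen k z kc).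
- unfold circle_mean at 1; f_equal.
  rewrite (RInt_ext (fun t => variance _)
    (fun s => 1 / (2 * PI) * RInt (fun t => D s t * D s t) 0 (2 * PI))).
  2: { intros s _; rewrite variance_eq; reflexivity. }
  symmetry; exact (RInt_scal_swap (fun s t => D s t * D s t) (1 / (2 * PI)) _ _ _ _ Dc).
Qed.

(** The variance is nonnegative as a mean of squares and nonpositive by telescoping with
    [u = f^2 <= M^2]. The squared deviation from [f z] is thus continuous and nonnegative with zero
    mean, so it vanishes on the circle; the angle [0] is left out, as vanishing is obtained at
    interior points of the interval. *)
Lemma constant_on_circle (M : R) :
  (forall z, Rabs (f z) <= M) ->
  forall z t, 0 < t < 2 * PI -> f (Cplus z (cis t)) = f z.
Proof.
intros fM z t Ht.
assert (dc : forall w, continuous (fun w => (f w - f z) * (f w - f z)) w).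
{ intros w; apply (continuous_sqr (fun w => f w - f z)), continuous_sub;
    [apply fc | apply continuous_const]. }
assert (vpos : 0 <= variance z).
{ rewrite variance_eq, <- (circle_mean_const 0 z); apply circle_mean_le; trivial.
  - intros; apply continuous_const.
  - intros; apply Rle_0_sqr. }
assert (vneg : variance z <= 0).
{ unfold variance; apply (circle_mean_increment_le_0 (fun w => f w * f w) (M * M) ).
  - intros; now apply continuous_sqr.
  - intros w; apply Rsqr_le_abs_1, Rle_trans with M; [apply fM | apply Rle_abs].
  - exact variance_sub_mean. }
assert (v0 : circle_mean (fun w => (f w - f z) * (f w - f z)) z = 0).
{ rewrite <- variance_eq; lra. }
assert (Hpi := two_PI_pos).
apply Rmult_integral in v0; destruct v0 as [v0 | v0].
{ assert (0 < 1 / (2 * PI)) by (apply Rdiv_lt_0_compat; lra); lra. }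
apply Rminus_diag_uniq, Rsqr_0_uniq.
apply (RInt_nonneg_eq_0 (fun t => (f (Cplus z (cis t)) - f z) * (f (Cplus z (cis t)) - f z)) 0 (2 * PI));
  trivial.
- intros s; now apply (continuous_on_circle (fun w => (f w - f z) * (f w - f z))).
- intros s; apply Rle_0_sqr.
Qed.
End Harmonic.

(** * From invariance along unit steps to constancy *)

Lemma constant_of_small_steps (g : R -> R) :
  (forall x u, -1 <= u <= 1 -> g (x + u) = g x) -> forall x, g x = g 0.
Proof.
intros step x.
(* Walk from [0] to [x] in [n > |x|] equal steps, each of length at most 1. *)
destruct (INR_unbounded (Rabs x)) as [n Hn].
assert (npos : 0 < INR n) by (assert (H := Rabs_pos x); lra).
assert (iter : forall k, g (INR k * (x / INR n)) = g 0).
{ induction k as [| k IH]; [simpl; f_equal; ring |].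
  rewrite S_INR, Rmult_plus_distr_r, Rmult_1_l, step; [exact IH |].
  apply Rabs_le_between; rewrite Rabs_div, (Rabs_right (INR n)) by lra.
  apply Rle_div_l; lra. }
rewrite <- (iter n); f_equal; field; lra.
Qed.

Theorem mainTheorem3 (f : C -> R)
  (f_bounded : exists M : R, forall z : C, Rabs (f z) <= M)
  (f_continuous : forall z : C, continuous f z)
  (f_mean : forall z : C,
     f z = 1 / (2 * PI) * RInt (fun t : R => f (Cplus z (cis t))) 0 (2 * PI)) :
  exists c : R, forall z : C, f z = c.
Proof.
destruct f_bounded as [M fM].
assert (step := constant_on_circle f f_continuous f_mean M fM).
assert (Hpi := PI_RGT_0).
(* Differences of two unit vectors are periods of [f]: adding [e^(it)] to [z + e^(is) - e^(it)]
   leads to [z + e^(is)], which is one step away from [z]. *)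
assert (step2 : forall z s t, 0 < s < 2 * PI -> 0 < t < 2 * PI ->
  f (Cplus z (Cminus (cis s) (cis t))) = f z).
{ intros z s t Hs Ht.
  rewrite <- (step (Cplus z (Cminus (cis s) (cis t))) t) by exact Ht.
  rewrite <- (step z s) by exact Hs; f_equal; ring. }
assert (horizontal : forall x y, f (x, y) = f (0, y)).
{ intros x y; apply (constant_of_small_steps (fun x => f (x, y))); clear x; intros x u Hu.
  (* The angles [acos (u / 2)] and its supplement have equal sines and cosines [u / 2] and
     [- u / 2], so the difference of the unit vectors is the real number [u]. *)
  assert (Ha := acos_bound_lt (u / 2) ltac:(lra)).
  rewrite <- (step2 (x, y) (acos (u / 2)) (PI - acos (u / 2))) by lra; f_equal.
  unfold cis, Cplus, Cminus, Copp; simpl.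
  rewrite Rtrigo_facts.cos_pi_minus, Rtrigo_facts.sin_pi_minus, cos_acos by lra.
  f_equal; field. }
assert (vertical : forall y, f (0, y) = f (0, 0)).
{ apply (constant_of_small_steps (fun y => f (0, y))); intros y u Hu.
  (* The two angles have equal cosines and sines [u / 2] and [- u / 2], giving the difference [i u];
     measuring them from [PI] keeps both strictly between [0] and [2 * PI]. *)
  assert (Ha := asin_bound (- u / 2)).
  rewrite <- (step2 (0, y) (asin (- u / 2) + PI) (PI - asin (- u / 2))) by lra; f_equal.
  unfold cis, Cplus, Cminus, Copp; simpl.
  rewrite neg_cos, neg_sin, Rtrigo_facts.cos_pi_minus, Rtrigo_facts.sin_pi_minus, sin_asin by lra.
  f_equal; field. }
exists (f (0, 0)); intros [x y]; now rewrite horizontal, vertical.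
Qed.
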